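(* Let $\sigma,\pi\in\mathcal{OP}_n$ be ordered set partitions with $|\sigma|=s$, $|\pi|=p$ and $\sigma\le\pi$. Write $\pi=(P_1,\dots,P_p)$, $\sigma=(S_1,\dots,S_s)$ and let $k_j$ be the number of blocks of $\sigma$ contained in $P_j$, $j\in\{1,\dots,p\}$. Then $k_1+k_2+\cdots+k_p=s$ and, as a poset, the interval $[\sigma,\pi]$ is canonically isomorphic to $\mathcal I_{k_1}\times\mathcal I_{k_2}\times\cdots\times\mathcal I_{k_p}$. More precisely, there exists a unique interval partition $\tau=(T_1,\dots,T_p)\in\mathcal I_s$ such that $$\pi=\Big(\bigcup_{i\in T_1}S_i,\bigcup_{i\in T_2}S_i,\dots,\bigcup_{i\in T_p}S_i\Big),$$ and the map $\Phi:\mathcal I_{T_1}\times\cdots\times\mathcal I_{T_p}\to[\sigma,\pi]$, $$(\tau_1,\dots,\tau_p)\mapsto\Big(\bigcup_{i\in T_{1,1}}S_i,\bigcup_{i\in T_{1,2}}S_i,\dots,\bigcup_{i\in T_{1,l_1}}S_i,\dots,\bigcup_{i\in T_{p,1}}S_i,\dots,\bigcup_{i\in T_{p,l_p}}S_i\Big),$$ where $\tau_i=(T_{i,1},\dots,T_{i,l_i})$, is a bijection; hence its inverse $\Psi=\Phi^{-1}$ establishes a bijection $[\sigma,\pi]\to\mathcal I_{k_1}\times\cdots\times\mathcal I_{k_p}$ with $k_i=|T_i|$.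
   Context: $[n]=\{1,\dots,n\}$. An ordered set partition of $[n]$ is a sequence $\pi=(P_1,\dots,P_p)$ of pairwise disjoint nonempty blocks with union $[n]$; $|\pi|=p$; $\mathcal{OP}_n$ is the set of them; $\bar\pi$ is the underlying set partition; set partitions are ordered by refinement. For $\pi=(P_1,\dots,P_p)$, $\sigma=(S_1,\dots,S_s)$ we write $\pi\le\sigma$ iff $\bar\pi\le\bar\sigma$ and, whenever $i<j$, $P_i\subseteq S_k$, $P_j\subseteq S_l$, one has $k\le l$; $[\sigma,\pi]=\{\rho\in\mathcal{OP}_n:\sigma\le\rho\le\pi\}$. For a finite totally ordered set $T$, $\mathcal I_T$ is the lattice (under refinement) of interval partitions of $T$, i.e. set partitions all of whose blocks are intervals of $T$; $\mathcal I_k=\mathcal I_{[k]}$, and $\mathcal I_T$ is identified with $\mathcal I_{|T|}$ via the order isomorphism $T\cong[|T|]$. The blocks of an interval partition are always listed in increasing order, $(T_1,\dots,T_p)$ with $i<j$ whenever $i\in T_a$, $j\in T_b$, $a<b$. *)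

(* Defs.v *)
From HB Require Import structures.
From mathcomp Require Import all_boot all_order.

Set Implicit Arguments.
Unset Strict Implicit.
Unset Printing Implicit Defensive.

Import Order.TTheory.

Section Refinement.
Variable X : finType.
Implicit Types P Q R : {set {set X}}.

Definition refines P Q := [forall B in P, exists C in Q, B \subset C].

Lemma refinesP P Q :
  reflect (forall B, B \in P -> exists2 C, C \in Q & B \subset C)
          (refines P Q).
Proof.
apply: (iffP forall_inP) => h B /h; first by case/exists_inP=> C; exists C.
by case=> C CQ sBC; apply/exists_inP; exists C.
Qed.

Lemma refines_refl P : refines P P.
Proof. by apply/refinesP => B BP; exists B. Qed.

Lemma refines_trans : transitive refines.
Proof.
move=> Q P R /refinesP PQ /refinesP QR; apply/refinesP => B /PQ[C /QR[D DR sCD]].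
by move=> sBC; exists D => //; apply: subset_trans sBC sCD.
Qed.

Lemma trivIset_sub_eq P A B C :
  trivIset P -> B \in P -> C \in P -> A != set0 ->
  A \subset B -> A \subset C -> B = C.
Proof.
move=> tP BP CP /set0Pn[x xA] /subsetP/(_ x xA) xB /subsetP/(_ x xA) xC.
by rewrite -(def_pblock tP BP xB) (def_pblock tP CP xC).
Qed.

Lemma refines_anti P Q :
  trivIset P -> trivIset Q -> set0 \notin P -> set0 \notin Q ->
  refines P Q -> refines Q P -> P = Q.
Proof.
suff sub P1 Q1 : trivIset P1 -> set0 \notin P1 ->
    refines P1 Q1 -> refines Q1 P1 -> P1 \subset Q1.
  by move=> tP tQ P0 Q0 PQ QP; apply/eqP; rewrite eqEsubset !sub.
move=> tP P0 /refinesP PQ /refinesP QP; apply/subsetP => B BP.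
have [C CQ sBC] := PQ B BP; have [D DP sCD] := QP C CQ.
have B0 : B != set0 by apply: contraNneq P0 => <-.
have BD := trivIset_sub_eq tP BP DP B0 (subxx B) (subset_trans sBC sCD).
suff -> : B = C by [].
by apply/eqP; rewrite eqEsubset sBC BD sCD.
Qed.

End Refinement.

(* The ground set [n] is 'I_n, and blocks are numbered from 0. *)
Definition is_osp n (s : seq {set 'I_n}) :=
  [&& set0 \notin s,
      pairwise (fun A B : {set 'I_n} => [disjoint A & B]) s
    & \bigcup_(A <- s) A == [set: 'I_n]].

Record osp n := Osp { osp_seq :> seq {set 'I_n}; ospP : is_osp osp_seq }.

HB.instance Definition _ n := [isSub for @osp_seq n].
HB.instance Definition _ n := [Choice of osp n by <:].

(* [set:: pi] is the set of blocks of pi. *)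
Definition osp_le n (pi sigma : osp n) :=
  refines [set:: pi] [set:: sigma] &&
  [forall i : 'I_(size pi), forall j : 'I_(size pi),
   forall k : 'I_(size sigma), forall l : 'I_(size sigma),
    [&& i < j, nth set0 pi i \subset nth set0 sigma k
             & nth set0 pi j \subset nth set0 sigma l] ==> (k <= l)].

Section OspOrder.
Variable n : nat.
Implicit Types pi sigma rho : osp n.

Lemma osp_neq0 pi i : i < size pi -> nth set0 pi i != set0.
Proof.
by move=> /(mem_nth set0) h; case/and3P: (ospP pi) => p0 _ _; apply: contraNneq p0 => <-.
Qed.

Lemma osp_nth_inj pi (A : {set 'I_n}) i j : i < size pi -> j < size pi ->
  A != set0 -> A \subset nth set0 pi i -> A \subset nth set0 pi j -> i = j.
Proof.
case/and3P: (ospP pi) => _ /(pairwiseP set0) disj _.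
wlog lt_ij : i j / i < j.
  move=> W ltip ltjp A0 sAi sAj.
  by have [/W|/W|//] := ltngtP i j; [apply | move=> h; apply/esym/h].
move=> ltip ltjp /set0Pn[x xA] /subsetP/(_ x xA) xi /subsetP/(_ x xA) xj.
by have /pred0P/(_ x)/= := disj i j ltip ltjp lt_ij; rewrite xi xj.
Qed.

Lemma osp_uniq pi : uniq pi.
Proof.
apply/(uniqP set0) => i j ltip ltjp eqij.
by apply: (osp_nth_inj ltip ltjp (osp_neq0 ltip)); rewrite // eqij.
Qed.

Lemma osp_trivIset pi : trivIset [set:: pi].
Proof.
apply/trivIsetP => A B; rewrite !inE => /(nthP set0)[i lti <-] /(nthP set0)[j ltj <-] neq.
rewrite -setI_eq0; apply/eqP/setP => x; rewrite !inE; apply/andP => -[xi xj].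
case/eqP: neq; congr nth.
have x0 : [set x] != set0 by apply/set0Pn; exists x; rewrite inE.
by apply: (osp_nth_inj lti ltj x0); rewrite sub1set.
Qed.

Lemma osp_set0 pi : set0 \notin [set:: pi].
Proof. by rewrite inE; case/and3P: (ospP pi). Qed.

Lemma osp_leP pi sigma :
  reflect (refines [set:: pi] [set:: sigma] /\
           forall i j k l, j < size pi -> k < size sigma -> l < size sigma ->
             i < j -> nth set0 pi i \subset nth set0 sigma k ->
             nth set0 pi j \subset nth set0 sigma l -> k <= l)
          (osp_le pi sigma).
Proof.
apply: (iffP andP) => -[ref h]; split=> //.
  move=> i j k l ltj ltk ltl ltij sik sjl; have lti := ltn_trans ltij ltj.
  move/forallP/(_ (Ordinal lti))/forallP/(_ (Ordinal ltj)): h.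
  move/forallP/(_ (Ordinal ltk))/forallP/(_ (Ordinal ltl))/implyP; apply.
  by apply/and3P.
apply/forallP => i; apply/forallP => j; apply/forallP => k; apply/forallP => l.
apply/implyP => /and3P[lt sik sjl].
exact: h (ltn_ord j) (ltn_ord k) (ltn_ord l) lt sik sjl.
Qed.

Lemma osp_le_refl : reflexive (@osp_le n).
Proof.
move=> pi; apply/osp_leP; split; first exact: refines_refl.
move=> i j k l ltj ltk ltl ltij sik sjl; have lti := ltn_trans ltij ltj.
rewrite -(osp_nth_inj lti ltk (osp_neq0 lti) _ sik) //.
by rewrite -(osp_nth_inj ltj ltl (osp_neq0 ltj) _ sjl) // ltnW.
Qed.

Lemma osp_le_anti : antisymmetric (@osp_le n).
Proof.
move=> pi sigma /andP[/osp_leP[r1 h1] /osp_leP[r2 _]].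
have eqs : [set:: pi] = [set:: sigma].
  by apply: refines_anti r1 r2; rewrite ?osp_trivIset ?osp_set0.
have mem : osp_seq pi =i osp_seq sigma by move=> A; move/setP/(_ A): eqs; rewrite !inE.
apply: val_inj => /=.
pose r A B := index A sigma <= index B sigma.
apply: (@sorted_eq_in _ r).
- by move=> A B C _ _ _; apply: leq_trans.
- move=> A B; rewrite !mem => Apos Bpos; rewrite /r -eqn_leq => /eqP.
  by move=> eqi; rewrite -(nth_index set0 Apos) eqi nth_index.
- rewrite sorted_pairwise; last by move=> A B C; apply: leq_trans.
  apply/(pairwiseP set0) => i j lti ltj ltij.
  have mi : nth set0 pi i \in (sigma : seq _) by rewrite -mem mem_nth.
  have mj : nth set0 pi j \in (sigma : seq _) by rewrite -mem mem_nth.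
  by apply: (h1 i j); rewrite ?index_mem ?nth_index.
- rewrite sorted_pairwise; last by move=> A B C; apply: leq_trans.
  apply/(pairwiseP set0) => i j lti ltj ltij.
  by rewrite /r !index_uniq ?osp_uniq // ltnW.
- by rewrite uniq_perm ?osp_uniq.
Qed.

Lemma osp_le_trans : transitive (@osp_le n).
Proof.
move=> sigma pi rho /osp_leP[r1 h1] /osp_leP[r2 h2]; apply/osp_leP; split.
  exact: refines_trans r1 r2.
move=> i j k l ltj ltk ltl ltij sik sjl; have lti := ltn_trans ltij ltj.
have up (tau1 tau2 : osp n) m : refines [set:: tau1] [set:: tau2] -> m < size tau1 ->
    exists2 a, a < size tau2 & nth set0 tau1 m \subset nth set0 tau2 a.
  move=> /refinesP r ltm.
  have [|C] := r (nth set0 tau1 m); first by rewrite inE mem_nth.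
  by rewrite inE => /(nthP set0)[a lta <-]; exists a.
have [a lta sia] := up _ _ i r1 lti; have [b ltb sjb] := up _ _ j r1 ltj.
have [c ltc sac] := up _ _ a r2 lta; have [d ltd sbd] := up _ _ b r2 ltb.
have -> : k = c := osp_nth_inj ltk ltc (osp_neq0 lti) sik (subset_trans sia sac).
have -> : l = d := osp_nth_inj ltl ltd (osp_neq0 ltj) sjl (subset_trans sjb sbd).
have := h1 i j a b ltj lta ltb ltij sia sjb; rewrite leq_eqVlt => /orP[/eqP eab|ltab].
  by rewrite (osp_nth_inj ltc ltd (osp_neq0 lta) sac) // eab.
exact: h2 ltb ltc ltd ltab sac sbd.
Qed.

End OspOrder.

Fact osp_display : Order.disp_t. Proof. exact: Order.Disp tt tt. Qed.

HB.instance Definition _ n :=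
  Order.Le_isPOrder.Build osp_display (osp n)
    (@osp_le_refl n) (@osp_le_anti n) (@osp_le_trans n).

Lemma osp_leE n (pi sigma : osp n) : (pi <= sigma)%O = osp_le pi sigma.
Proof. by []. Qed.

Section IntervalPartition.
Context {d : Order.disp_t} {X : finOrderType d}.
Implicit Types T B C : {set X}.

Definition is_interval T B :=
  (B \subset T) &&
  [forall x in B, forall y in B, forall z in T, (x <= z <= y)%O ==> (z \in B)].

Definition is_intpart T (P : {set {set X}}) :=
  partition P T && [forall B in P, is_interval T B].

(* The lattice I_T of interval partitions of a subset T of the chain X. *)
Record intpart T := IntPart
  { intpart_set :> {set {set X}}; intpartP : is_intpart T intpart_set }.

HB.instance Definition _ T := [isSub for @intpart_set T].
HB.instance Definition _ T := [Finite of intpart T by <:].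

Definition block_le B C :=
  (B == C) || [forall x in B, forall y in C, (x < y)%O].

(* The blocks of P listed in increasing order: block_le is total on them. *)
Definition intpart_seq T (P : intpart T) : seq {set X} := sort block_le (enum P).

Lemma intpart_seq_sorted T (P : intpart T) : sorted block_le (intpart_seq P).
Proof.
case/andP: (intpartP P) => /and3P[_ tP P0] /forall_inP iP.
apply: (@sort_sorted_in _ (mem P)); last by apply/allP => B; rewrite mem_enum.
move=> B C BP CP; rewrite /block_le eq_sym; case: eqVneq => //= neqCB.
have disj x : x \in B -> x \in C -> False.
  move=> xB xC; case/eqP: neqCB.
  by rewrite -(def_pblock tP BP xB) (def_pblock tP CP xC).
have conv D x y z : D \in mem P -> x \in D -> y \in D -> z \in T ->
    (x <= z)%O -> (z <= y)%O -> z \in D.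
  move=> DP xD yD zT xz zy; case/andP: (iP D DP) => _ /forall_inP/(_ x xD).
  by move=> /forall_inP/(_ y yD)/forall_inP/(_ z zT); rewrite xz zy.
have inT D x : D \in mem P -> x \in D -> x \in T.
  by move=> /iP/andP[/subsetP s _]; apply: s.
case: (boolP [forall x in B, _]) => //= /forall_inPn[x xB /forall_inPn[y yC]].
rewrite -leNgt => le_yx; apply/forall_inP => v vC; apply/forall_inP => u uB.
rewrite ltNge; apply/negP => le_uv.
have [le_uy|lt_yu] := leP u y.
  exact: disj y (conv B u x y BP uB xB (inT _ _ CP yC) le_uy le_yx) yC.
exact: disj u uB (conv C y v u CP yC vC (inT _ _ BP uB) (ltW lt_yu) le_uv).
Qed.

Lemma intpart_le_refl T : reflexive (fun P Q : intpart T => refines P Q).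
Proof. by move=> P; apply: refines_refl. Qed.

Lemma intpart_le_anti T : antisymmetric (fun P Q : intpart T => refines P Q).
Proof.
move=> P Q /andP[PQ QP]; apply: val_inj.
case/andP: (intpartP P) => /and3P[_ tP P0] _.
case/andP: (intpartP Q) => /and3P[_ tQ Q0] _.
exact: refines_anti PQ QP.
Qed.

Lemma intpart_le_trans T : transitive (fun P Q : intpart T => refines P Q).
Proof. by move=> Q P R; apply: refines_trans. Qed.

End IntervalPartition.

Fact intpart_display : Order.disp_t. Proof. exact: Order.Disp tt tt. Qed.

HB.instance Definition _ d (X : finOrderType d) (T : {set X}) :=
  Order.Le_isPOrder.Build intpart_display (intpart T)
    (@intpart_le_refl d X T) (@intpart_le_anti d X T) (@intpart_le_trans d X T).

Lemma intpart_leE d (X : finOrderType d) (T : {set X}) (P Q : intpart T) :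
  (P <= Q)%O = refines P Q.
Proof. by []. Qed.

(* The union of the S_i, i in B, where sigma = (S_0, ..., S_(s-1)). *)
Definition merge_block n (sigma : osp n) (B : {set 'I_(size sigma)}) : {set 'I_n} :=
  \bigcup_(i in B) nth set0 sigma i.

Definition merge_blocks n (sigma : osp n) (L : seq {set 'I_(size sigma)}) :
  seq {set 'I_n} := map (@merge_block n sigma) L.

Definition nblocks_in n (sigma : osp n) (A : {set 'I_n}) : nat :=
  count (fun S : {set 'I_n} => S \subset A) sigma.

Definition osp_interval n (sigma pi : osp n) :=
  {rho : osp n | (sigma <= rho <= pi)%O}.

Definition intpart_prod p (m : 'I_p -> nat) (T : forall j, {set 'I_(m j)}) :=
  {dffun forall j : 'I_p, intpart (T j)}.

Definition prod_le p (m : 'I_p -> nat) (T : forall j, {set 'I_(m j)})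
    (t u : intpart_prod T) :=
  [forall j, (t j <= u j)%O].

(* e is the (necessarily unique) order isomorphism from [k] onto T; it induces
   the identification of I_k with I_T, P |-> {e(B) : B in P}. *)
Definition order_iso_onto k s (e : 'I_k -> 'I_s) (T : {set 'I_s}) :=
  {mono e : x y / (x <= y)%O} /\ e @: [set: 'I_k] = T.

(* Main.v *)
Require Import Defs.
From HB Require Import structures.
From mathcomp Require Import all_boot all_order.

Set Implicit Arguments.
Unset Strict Implicit.
Unset Printing Implicit Defensive.

Import Order.TTheory.

(** Everything above [sigma] is obtained by gluing consecutive blocks of
    [sigma].  If [sigma <= rho], each block of [rho] is a union of blocks
    [S_i], and the order condition on [rho] forces the indices [i] collected
    in one block to be consecutive: if [S_x] and [S_y] lie in the same block
    and [x <= z <= y], the block containing [S_z] can come neither before nor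
    after.  So [tau |-> merge_of tau] is an order isomorphism from the interval
    partitions of the index set of [sigma] onto the ordered set partitions
    above [sigma] ([merge_of_ge], [merge_of_le], [merge_of_surj]).  In
    particular [pi] is [merge_of tau] for a unique [tau], and the interval
    [[sigma, pi]] corresponds to the interval partitions finer than [tau].

    An interval partition finer than [tau] is the same thing as a choice of
    an interval partition of every block [T_j] of [tau]: [join] collects the
    chosen blocks, and it is an order isomorphism of the product onto the
    partitions below [tau] ([join_le_coarse], [join_le], [join_surj]).  Hence
    [Phi] is [merge_of] after [join].  Transporting each factor along the
    increasing enumeration of [T_j] ([push]) replaces [T_j] by an initial
    segment of length [k_j].

    All constructions of interval partitions go through one
    characterization: the interval partitions of [T], with blocks listed
    increasingly, are exactly the sequences of nonempty sets with union [T]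
    in which every element of a block is smaller than every element of each
    later block ([intpart_seq_chain], [intpart_of_chain],
    [intpart_seq_of_chain]).  This is also what identifies the listing order
    of [Phi] with a plain concatenation. *)

(** * Interval partitions as increasing chains of blocks *)

Section Chains.
Context {d : Order.disp_t} {X : finOrderType d}.
Implicit Types (T B C : {set X}) (L : seq {set X}).

Definition block_lt B C := [forall x in B, forall y in C, (x < y)%O].

Lemma block_ltP B C :
  reflect {in B & C, forall x y, (x < y)%O} (block_lt B C).
Proof.
apply: (iffP forall_inP) => h x; first by move=> y xB; move/forall_inP: (h x xB); apply.
by move=> xB; apply/forall_inP => y; apply: h.
Qed.

Definition is_chain T L :=
  [&& set0 \notin L, pairwise block_lt L & \bigcup_(B <- L) B == T].

Lemma mem_bigcup_seq (Y : finType) (L : seq {set Y}) x :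
  reflect (exists2 B, B \in L & x \in B) (x \in \bigcup_(B <- L) B).
Proof. by rewrite bigcup_seq; apply: bigcupP. Qed.

(** The default value [set0] is what makes the bound on [i] automatic: in the
    chain lemmas below, membership replaces every hypothesis on indices. *)
Lemma mem_nth_set (Y : finType) (L : seq {set Y}) i x :
  x \in nth set0 L i -> i < size L.
Proof. by rewrite ltnNge; apply: contraL => h; rewrite nth_default ?inE. Qed.

Lemma chain_nth_lt L i j x y : pairwise block_lt L ->
  x \in nth set0 L i -> y \in nth set0 L j -> i < j -> (x < y)%O.
Proof.
move=> /(pairwiseP set0) pL xi yj ij.
move/block_ltP: (pL i j (mem_nth_set xi) (mem_nth_set yj) ij).
exact.
Qed.

Lemma chain_nth_le L i j x y : pairwise block_lt L ->
  x \in nth set0 L i -> y \in nth set0 L j -> (x <= y)%O -> i <= j.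
Proof.
move=> pL xi yj; rewrite leNgt leqNgt; apply: contra.
exact: chain_nth_lt pL yj xi.
Qed.

Lemma chain_nth_inj L i j x : pairwise block_lt L ->
  x \in nth set0 L i -> x \in nth set0 L j -> i = j.
Proof.
move=> pL xi xj; apply/eqP.
by rewrite eqn_leq (chain_nth_le pL xi xj) ?(chain_nth_le pL xj xi).
Qed.

(** A block is convex because the index of the block containing [x] is a
    nondecreasing function of [x]. *)
Lemma chain_intpart T L : is_chain T L -> is_intpart T [set:: L].
Proof.
case/and3P=> L0 pL /eqP uL; apply/andP; split.
  apply/and3P; split; last by rewrite inE.
    apply/eqP; rewrite -uL bigcup_seq /cover.
    by apply: eq_bigl => B; rewrite inE.
  apply/trivIsetP => B C; rewrite !inE => /(nthP set0)[i _ <-] /(nthP set0)[j _ <-].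
  apply: contraR => /pred0Pn[x /andP[xi xj]].
  by rewrite (chain_nth_inj pL xi xj).
apply/forall_inP => B; rewrite inE => BL; apply/andP; split.
  by apply/subsetP => x xB; rewrite -uL; apply/mem_bigcup_seq; exists B.
case/(nthP set0): BL => i _ <-.
apply/forall_inP => x xB; apply/forall_inP => y yB; apply/forall_inP => z.
rewrite -{1}uL => /mem_bigcup_seq[C /(nthP set0)[j _ <-] zC].
apply/implyP => /andP[xz zy].
suff -> : i = j by [].
by apply/eqP; rewrite eqn_leq (chain_nth_le pL xB zC) ?(chain_nth_le pL zC yB).
Qed.

Lemma mem_intpart_seq T (P : intpart T) B : (B \in intpart_seq P) = (B \in intpart_set P).
Proof. by rewrite /intpart_seq mem_sort mem_enum. Qed.

Lemma intpart_neq0 T (P : intpart T) B : B \in intpart_set P -> B != set0.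
Proof.
by case/andP: (intpartP P) => /and3P[_ _ P0] _ BP; apply: contraNneq P0 => <-.
Qed.

Lemma block_lt_irr B : B != set0 -> block_lt B B = false.
Proof.
case/set0Pn=> x xB; apply/negP => /block_ltP/(_ x x xB xB).
by rewrite ltxx.
Qed.

(** Nonemptiness of the middle set is essential, since [set0] is related to
    everything on both sides. *)
Lemma block_lt_trans B C D : C != set0 -> block_lt B C -> block_lt C D -> block_lt B D.
Proof.
case/set0Pn=> y yC /block_ltP BC /block_ltP CD; apply/block_ltP => x z xB zD.
exact: lt_trans (BC x y xB yC) (CD y z yC zD).
Qed.

(** Sortedness for [block_le] gives the relation only between consecutive
    blocks; it extends to all pairs because the blocks are nonempty, and it
    becomes strict because they are pairwise different. *)
Lemma intpart_seq_chain T (P : intpart T) : is_chain T (intpart_seq P).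
Proof.
have neq0 B : B \in intpart_seq P -> B != set0.
  by rewrite mem_intpart_seq; apply: intpart_neq0.
apply/and3P; split.
- by apply/negP => /neq0; rewrite eqxx.
- have le_tr : {in intpart_seq P & &, transitive (@block_le _ X)}.
    move=> C B D CP _ _ /orP[/eqP->//|lBC] /orP[/eqP<-|lCD].
      by apply/orP; right.
    by apply/orP; right; apply: block_lt_trans lBC lCD; apply: neq0.
  have := intpart_seq_sorted P.
  rewrite (sorted_pairwise_in le_tr); last by apply/allP.
  have U : uniq (intpart_seq P) by rewrite /intpart_seq sort_uniq enum_uniq.
  move=> /(pairwiseP set0) h; apply/(pairwiseP set0) => i j ilt jlt ij.
  case/orP: (h i j ilt jlt ij) => //.
  by rewrite nth_uniq // ltn_eqF.
- apply/eqP; rewrite -[RHS](cover_partition (proj1 (andP (intpartP P)))).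
  by rewrite bigcup_seq; apply: eq_bigl => B; rewrite mem_intpart_seq.
Qed.

Lemma pairwise_intpart_seq T (P : intpart T) : pairwise block_lt (intpart_seq P).
Proof. by case/and3P: (intpart_seq_chain P). Qed.

Definition intpart_of_chain T L (cL : is_chain T L) : intpart T :=
  IntPart (chain_intpart cL).

(** Both sides are strictly increasing for [block_lt] and have the same
    members, so they are the same sequence. *)
Lemma intpart_seq_of_chain T L (cL : is_chain T L) :
  intpart_seq (intpart_of_chain cL) = L.
Proof.
set P := intpart_of_chain cL.
have memL : intpart_seq P =i L by move=> B; rewrite mem_intpart_seq inE.
have neq0 B : B \in intpart_seq P -> B != set0.
  by rewrite mem_intpart_seq; apply: intpart_neq0.
apply: (@irr_sorted_eq_in _ block_lt) => //.
- by move=> C B D CP _ _; apply: block_lt_trans; apply: neq0.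
- by move=> B /neq0/block_lt_irr.
- exact/pairwise_sorted/pairwise_intpart_seq.
- by case/and3P: (cL) => _ pL _; apply: pairwise_sorted.
Qed.

Lemma intpart_cover T (P : intpart T) x : x \in T -> exists2 B, B \in intpart_set P & x \in B.
Proof.
case/and3P: (intpart_seq_chain P) => _ _ /eqP uP.
rewrite -{1}uP => /mem_bigcup_seq[B].
by rewrite mem_intpart_seq; exists B.
Qed.

Lemma intpart_sub T (P : intpart T) B : B \in intpart_set P -> B \subset T.
Proof.
case/andP: (intpartP P) => /cover_partition uP _ BP.
by rewrite -uP; apply: bigcup_sup BP.
Qed.

Lemma sum_card_intpart_seq T (P : intpart T) :
  \sum_(B <- intpart_seq P) #|B| = #|T|.
Proof.
rewrite (card_partition (proj1 (andP (intpartP P)))).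
by rewrite (perm_big (enum (intpart_set P))) ?perm_sort // big_enum.
Qed.

End Chains.

(** Refinement is defined by inclusions between blocks only, so any map of
    blocks that preserves and reflects inclusion preserves and reflects it.
    Used both for the image under an order embedding and for unions of blocks
    of [sigma]. *)
Lemma refines_map (X Y : finType) (f : {set X} -> {set Y}) (P Q : {set {set X}})
    (P' Q' : {set {set Y}}) :
  (forall B, reflect (exists2 A, A \in P & B = f A) (B \in P')) ->
  (forall B, reflect (exists2 A, A \in Q & B = f A) (B \in Q')) ->
  (forall A B, (f A \subset f B) = (A \subset B)) ->
  refines P' Q' = refines P Q.
Proof.
move=> P'P Q'P fS; apply/refinesP/refinesP => h A.
  move=> AP; have /h[C /Q'P[B BQ ->]] : f A \in P' by apply/P'P; exists A.
  by rewrite fS; exists B.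
case/P'P=> A1 /h[B BQ AB] ->; exists (f B); last by rewrite fS.
by apply/Q'P; exists B.
Qed.

(** * Transport along an order embedding *)

Section Transport.
Context {d d' : Order.disp_t} {X : finOrderType d} {Y : finOrderType d'}.
Variables (e : X -> Y) (S : {set X}) (T : {set Y}).
Hypotheses (e_mono : {mono e : x y / (x <= y)%O}) (eS : e @: S = T).

Let e_inj : injective e := inc_inj e_mono.

Lemma push_chain (P : intpart S) : is_chain T [seq e @: (B : {set X}) | B <- intpart_seq P].
Proof.
case/and3P: (intpart_seq_chain P) => P0 pP /eqP uP; apply/and3P; split.
- apply/mapP => -[B BP /esym/eqP]; rewrite imset_eq0 => /eqP B0.
  by rewrite B0 (negPf P0) in BP.
- rewrite pairwise_map; apply: sub_pairwise pP => B C /block_ltP BC.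
  apply/block_ltP => _ _ /imsetP[x xB ->] /imsetP[y yC ->].
  by rewrite (leW_mono e_mono) BC.
- apply/eqP/setP => y; rewrite -eS; apply/mem_bigcup_seq/imsetP.
    case=> _ /mapP[B BP ->] /imsetP[x xB ->]; exists x => //.
    by rewrite -uP; apply/mem_bigcup_seq; exists B.
  case=> x; rewrite -{1}uP => /mem_bigcup_seq[B BP xB] ->; exists (e @: B); last exact: imset_f.
  exact: map_f.
Qed.

Definition push P := intpart_of_chain (push_chain P).

Lemma push_set P : intpart_set (push P) = [set e @: (B : {set _}) | B in intpart_set P].
Proof.
apply/setP => B; rewrite inE; apply/mapP/imsetP => -[A];
  by rewrite -?mem_intpart_seq => AP ->; exists A; rewrite -?mem_intpart_seq.
Qed.

Lemma push_le P Q : (push P <= push Q)%O = (P <= Q)%O.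
Proof.
rewrite !intpart_leE.
apply: (@refines_map _ _ (fun B : {set X} => e @: B)); rewrite ?push_set.
- by move=> B; apply: imsetP.
- by move=> B; apply: imsetP.
- move=> A B; apply/idP/idP => [/subsetP h|]; last exact: imsetS.
  by apply/subsetP => x /(imset_f e)/h; rewrite mem_imset.
Qed.

(** The preimage under [push] is the partition by inverse images
    [S :&: e @^-1: B]; these are mapped back onto [B] because [e] covers
    [T]. *)
Lemma push_surj (Q : intpart T) : exists P, push P == Q.
Proof.
have im_pre B : B \in intpart_set Q -> e @: (S :&: e @^-1: B) = B.
  move=> /intpart_sub sBT; apply/setP => y; apply/imsetP/idP.
    by case=> x; rewrite !inE => /andP[_ xB] ->.
  move=> yB; have := subsetP sBT y yB; rewrite -eS => /imsetP[x xS def_y].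
  by exists x; rewrite // !inE xS -def_y.
have cP : is_chain S [seq S :&: e @^-1: (B : {set Y}) | B <- intpart_seq Q].
  case/and3P: (intpart_seq_chain Q) => Q0 pQ /eqP uQ; apply/and3P; split.
  - apply/mapP => -[B BP B0].
    have := im_pre B; rewrite -mem_intpart_seq BP -B0 imset0 => /(_ isT) B0'.
    by rewrite -B0' (negPf Q0) in BP.
  - rewrite pairwise_map; apply: sub_pairwise pQ => B C /block_ltP BC.
    apply/block_ltP => x y; rewrite !inE => /andP[_ xB] /andP[_ yC].
    by rewrite -(leW_mono e_mono) BC.
  - apply/eqP/setP => x; apply/mem_bigcup_seq/idP.
      by case=> _ /mapP[B BP ->]; rewrite inE => /andP[].
    move=> xS; have /(intpart_cover Q)[B BQ exB] : e x \in T by rewrite -eS imset_f.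
    exists (S :&: e @^-1: B); last by rewrite !inE xS.
    by apply: map_f; rewrite mem_intpart_seq.
exists (intpart_of_chain cP); apply/eqP/val_inj => /=; apply/setP => B.
rewrite inE intpart_seq_of_chain -map_comp -[RHS]mem_intpart_seq.
have -> // : [seq ((fun A : {set X} => e @: A) \o (fun B : {set Y} => S :&: e @^-1: B)) B
  | B <- intpart_seq Q] = intpart_seq Q.
by apply/map_id_in => A; rewrite mem_intpart_seq => /im_pre.
Qed.

End Transport.

Lemma order_iso_exists (s k : nat) (T : {set 'I_s}) :
  k = #|T| -> exists e : 'I_k -> 'I_s, order_iso_onto e T.
Proof.
move=> ->; pose e := @Order.EnumVal.enum_val _ _ (mem T).
have e_mono : {mono e : x y / (x <= y)%O} by exact: Order.EnumVal.le_enum_val le_total _.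
exists e; split=> //; apply/eqP; rewrite eqEcard card_imset ?cardsT ?card_ord ?leqnn ?andbT.
  by apply/subsetP => _ /imsetP[i _ ->]; apply: Order.EnumVal.enum_valP.
exact: inc_inj.
Qed.

Lemma pairwise_flatten (X : Type) (r : rel X) (ss : seq (seq X)) :
  pairwise r (flatten ss) = all (pairwise r) ss && pairwise (allrel r) ss.
Proof.
elim: ss => //= s ss IH; rewrite pairwise_cat IH.
have -> : allrel r s (flatten ss) = all (allrel r s) ss.
  by elim: ss {IH} => [|t ss IH] /=; rewrite ?allrel0r // allrel_catr IH.
by rewrite andbCA -andbA; congr (_ && _); apply: andbCA.
Qed.

Lemma pairwise_enum_ord p : pairwise (fun i j : 'I_p => i < j) (enum 'I_p).
Proof.
rewrite -(@pairwise_map _ _ (@nat_of_ord p) ltn) val_enum_ord.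
by rewrite -sorted_pairwise ?iota_ltn_sorted //; apply: ltn_trans.
Qed.

(** * Refining each block of an interval partition *)

Section Join.
Context {d : Order.disp_t} {X : finOrderType d}.
Variables (U : {set X}) (tau : intpart U) (p : nat).
(* The number of blocks is kept as a variable, so that the blocks can be indexed
   by ['I_(size pi)] when only an equation relates it to the size of [tau]. *)
Hypothesis size_tau : size (intpart_seq tau) = p.

Let T (j : 'I_p) := nth set0 (intpart_seq tau) j.
Let prod := {dffun forall j : 'I_p, intpart (T j)}.
Implicit Types t u : prod.

Lemma coarse_block j : T j \in intpart_set tau.
Proof. by rewrite -mem_intpart_seq mem_nth // size_tau. Qed.

Lemma coarse_blockP B : B \in intpart_set tau -> exists j, B = T j.
Proof.
rewrite -mem_intpart_seq => /(nthP set0)[i]; rewrite size_tau => lt_ip <-.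
by exists (Ordinal lt_ip).
Qed.

Lemma coarse_block_inj (i j : 'I_p) x : x \in T i -> x \in T j -> i = j.
Proof.
by move=> xi xj; apply/val_inj/(chain_nth_inj (pairwise_intpart_seq tau) xi xj).
Qed.

Lemma coarse_block_sub_inj (i j : 'I_p) (A B : {set X}) : A != set0 -> A \subset B ->
  A \subset T i -> B \subset T j -> i = j.
Proof.
case/set0Pn=> x xA /subsetP AB /subsetP Ai /subsetP Bj.
by apply: (@coarse_block_inj _ _ x); [apply: Ai | apply/Bj/AB].
Qed.

(** Blocks with the same [j] are ordered since they come from one interval
    partition; blocks with indices [i < j] are ordered since they lie in [T_i]
    and [T_j]. *)
Lemma join_chain t : is_chain U (flatten [seq intpart_seq (t j) | j <- enum 'I_p]).
Proof.
apply/and3P; split.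
- apply/flatten_mapP => -[j _]; apply/negP.
  by case/and3P: (intpart_seq_chain (t j)).
- rewrite pairwise_flatten; apply/andP; split.
    by apply/allP => _ /mapP[j _ ->]; apply: pairwise_intpart_seq.
  rewrite pairwise_map; apply: sub_pairwise (pairwise_enum_ord p) => i j ij.
  apply/allrelP => B C; rewrite !mem_intpart_seq => /intpart_sub/subsetP Bi /intpart_sub/subsetP Cj.
  apply/block_ltP => x y /Bi xi /Cj yj.
  exact: chain_nth_lt (pairwise_intpart_seq tau) xi yj ij.
- apply/eqP/setP => x; apply/mem_bigcup_seq/idP.
    case=> B /flatten_mapP[j _]; rewrite mem_intpart_seq => /intpart_sub sBT xB.
    apply: (subsetP (intpart_sub (coarse_block j))); exact: subsetP sBT x xB.
  case/(intpart_cover tau)=> _ /coarse_blockP[j ->] /(intpart_cover (t j))[B Bj xB].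
  by exists B => //; apply/flatten_mapP; exists j; rewrite ?mem_enum ?mem_intpart_seq.
Qed.

Definition join t : intpart U := intpart_of_chain (join_chain t).

Lemma mem_join t B : reflect (exists j, B \in intpart_set (t j)) (B \in intpart_set (join t)).
Proof.
rewrite inE; apply: (iffP (flatten_mapP)) => [[j _]|[j Bj]].
  by rewrite mem_intpart_seq; exists j.
by exists j; rewrite ?mem_enum ?mem_intpart_seq.
Qed.

Lemma join_le_coarse t : (join t <= tau)%O.
Proof.
rewrite intpart_leE; apply/refinesP => B /mem_join[j /intpart_sub sBT].
by exists (T j) => //; apply: coarse_block.
Qed.

(** For the direct implication, a nonempty block of [t j] that lies in a block
    of [u i] meets both [T_j] and [T_i], so that [i = j]: the comparison of the
    joins splits into comparisons of the factors. *)
Lemma join_le t u : (join t <= join u)%O = [forall j, (t j <= u j)%O].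
Proof.
rewrite intpart_leE; apply/refinesP/forallP => h.
  move=> j; rewrite intpart_leE; apply/refinesP => B Bt.
  have [|C /mem_join[i Cu] BC] := h B; first by apply/mem_join; exists j.
  have eji := coarse_block_sub_inj (intpart_neq0 Bt) BC (intpart_sub Bt) (intpart_sub Cu).
  by subst i; exists C.
move=> B /mem_join[j Bt]; move: (h j); rewrite intpart_leE => /refinesP/(_ B Bt)[C Cu BC].
by exists C => //; apply/mem_join; exists j.
Qed.

(** The factor at [j] consists of the blocks of [rho] contained in [T_j];
    they fill [T_j] because every block of [rho] lies in a single block of
    [tau]. *)
Lemma join_surj (rho : intpart U) : (rho <= tau)%O -> exists t, join t = rho.
Proof.
rewrite intpart_leE => /refinesP le_rho.
have cR j : is_chain (T j) [seq B : {set X} <- intpart_seq rho | B \subset T j].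
  case/and3P: (intpart_seq_chain rho) => rho0 prho _; apply/and3P; split.
  - by rewrite mem_filter (negPf rho0) andbF.
  - exact: pairwise_filter.
  - apply/eqP/setP => x; apply/mem_bigcup_seq/idP.
      by case=> B; rewrite mem_filter => /andP[/subsetP s _] /s.
    move=> xT; have xU := subsetP (intpart_sub (coarse_block j)) x xT.
    have [B Brho xB] := intpart_cover rho xU.
    exists B => //; rewrite mem_filter mem_intpart_seq Brho andbT.
    have [_ /coarse_blockP[i ->] sBT] := le_rho B Brho.
    by rewrite (coarse_block_inj xT (subsetP sBT x xB)).
exists (finfun (fun j => intpart_of_chain (cR j)) : prod).
apply: val_inj; apply/setP => B; apply/mem_join/idP => [[j]|Brho].
  by rewrite ffunE inE mem_filter mem_intpart_seq => /andP[].
have [_ /coarse_blockP[j ->] sBT] := le_rho B Brho.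
by exists j; rewrite ffunE inE mem_filter mem_intpart_seq sBT.
Qed.

End Join.

(** * Gluing consecutive blocks of an ordered set partition *)

Section Merge.
Variables (n : nat) (sigma : osp n).
Let s := size sigma.
Local Notation S i := (nth set0 sigma i).
Local Notation merge := (@merge_block n sigma).
Implicit Types (B C : {set 'I_s}) (tau : intpart [set: 'I_s]) (rho : osp n).

Lemma osp_cover rho x : exists j : 'I_(size rho), x \in nth set0 rho j.
Proof.
have : x \in [set: 'I_n] by [].
case/and3P: (ospP rho) => _ _ /eqP<- /mem_bigcup_seq[B /(nthP set0)[j lt_j <-] xB].
by exists (Ordinal lt_j).
Qed.

Lemma osp_mem_inj rho x i j : x \in nth set0 rho i -> x \in nth set0 rho j -> i = j.
Proof.
move=> xi xj; apply: (@osp_nth_inj _ rho [set x]); rewrite ?sub1set //.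
- exact: mem_nth_set xi.
- exact: mem_nth_set xj.
- by apply/set0Pn; exists x; rewrite inE.
Qed.

Lemma mem_merge B (i : 'I_s) x : x \in S i -> (x \in merge B) = (i \in B).
Proof.
move=> xi; apply/bigcupP/idP => [[j jB xj]|iB]; last by exists i.
by rewrite (val_inj (osp_mem_inj xi xj) : i = j).
Qed.

Lemma sub_merge B (i : 'I_s) : (S i \subset merge B) = (i \in B).
Proof.
apply/idP/idP => [/subsetP h|iB]; last exact: (bigcup_sup i).
have /set0Pn[x xi] := osp_neq0 (ltn_ord i).
by rewrite -(mem_merge B xi) h.
Qed.

(** Since the [S_i] are nonempty and disjoint, the union determines the set of
    indices, and the gluing map is an embedding for inclusion. *)
Lemma merge_subset B C : (merge B \subset merge C) = (B \subset C).
Proof.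
apply/idP/idP => [sBC|/subsetP sBC].
  by apply/subsetP => i; rewrite -!sub_merge => /subset_trans; apply.
by apply/bigcupsP => i /sBC; rewrite sub_merge.
Qed.

Lemma merge_osp tau : is_osp (merge_blocks (intpart_seq tau)).
Proof.
case/and3P: (intpart_seq_chain tau) => tau0 ptau /eqP utau; apply/and3P; split.
- apply/mapP => -[B Btau B0]; move: Btau.
  have -> : B = set0; last by rewrite (negPf tau0).
  by apply/eqP; rewrite -subset0 -merge_subset -B0 sub0set.
- rewrite pairwise_map; apply: sub_pairwise ptau => B C /block_ltP BC.
  apply/pred0P => x /=; apply/negP => /andP[].
  have [i xi] := osp_cover sigma x; rewrite !(mem_merge _ xi) => iB iC.
  by have := BC i i iB iC; rewrite ltxx.
- apply/eqP/setP => x; rewrite inE; apply/mem_bigcup_seq.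
  have [i xi] := osp_cover sigma x.
  have [B Btau iB] := intpart_cover tau (in_setT i).
  by exists (merge B); rewrite ?(mem_merge _ xi) // map_f // mem_intpart_seq.
Qed.

Definition merge_of tau : osp n := Osp (merge_osp tau).

Lemma nth_merge_of tau j :
  nth set0 (merge_of tau) j = merge (nth set0 (intpart_seq tau) j).
Proof.
have [lt_j|le_j] := ltnP j (size (intpart_seq tau)); first exact: nth_map.
by rewrite !nth_default ?size_map // /merge_block big_set0.
Qed.

Lemma merge_of_ge tau : (sigma <= merge_of tau)%O.
Proof.
rewrite osp_leE; apply/osp_leP; split.
  apply/refinesP => A; rewrite inE => /(nthP set0)[i lt_i <-].
  have [B Btau iB] := intpart_cover tau (in_setT (Ordinal lt_i)).
  exists (merge B); first by rewrite inE map_f // mem_intpart_seq.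
  by rewrite (sub_merge B (Ordinal lt_i)).
move=> i j k l lt_j _ _ ij; have lt_i := ltn_trans ij lt_j.
rewrite !nth_merge_of (sub_merge _ (Ordinal lt_i)) (sub_merge _ (Ordinal lt_j)) => ik jl.
by apply: (chain_nth_le (pairwise_intpart_seq tau) ik jl); apply: ltnW.
Qed.

(** Refinement transfers by [merge_subset].  The order condition follows from
    refinement here: on both sides the blocks are listed along the chain of
    indices, so elements [x < y] of two blocks of [tau] lie in blocks of [tau']
    listed in the same order. *)
Lemma merge_of_le tau tau' : (merge_of tau <= merge_of tau')%O = (tau <= tau')%O.
Proof.
have mapmP t A : reflect (exists2 B, B \in intpart_set t & A = merge B)
    (A \in [set:: merge_of t]).
  rewrite inE; apply: (iffP mapP) => -[B Bt ->]; exists B => //.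
    by rewrite -mem_intpart_seq.
  by rewrite mem_intpart_seq.
have refE := refines_map (mapmP tau) (mapmP tau') merge_subset.
rewrite osp_leE intpart_leE; apply/osp_leP/idP => [[]|le_tau]; first by rewrite refE.
split; first by rewrite refE.
move=> i j k l lt_j _ _ ij; rewrite !nth_merge_of !merge_subset => /subsetP ik /subsetP jl.
have nz m : m < size (merge_of tau) -> nth set0 (intpart_seq tau) m != set0.
  by rewrite size_map => lt_m; apply/(@intpart_neq0 _ _ _ tau); rewrite -mem_intpart_seq mem_nth.
have /set0Pn[x xi] := nz i (ltn_trans ij lt_j).
have /set0Pn[y yj] := nz j lt_j.
apply: (chain_nth_le (pairwise_intpart_seq tau') (ik x xi) (jl y yj)).
exact/ltW/(chain_nth_lt (pairwise_intpart_seq tau) xi yj).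
Qed.

Lemma merge_of_inj : injective merge_of.
Proof. by move=> t u e; apply: le_anti; rewrite -!merge_of_le e lexx. Qed.

(** The interval partition groups the indices [i] by the block of [rho]
    containing [S_i]; the order condition in [sigma <= rho] says exactly that
    this grouping is increasing. *)
Lemma merge_of_surj rho : (sigma <= rho)%O -> exists tau, merge_of tau = rho.
Proof.
rewrite osp_leE => /osp_leP[/refinesP ref ord].
(* The indices of the blocks of [sigma] glued together in [A]. *)
pose D (A : {set 'I_n}) : {set 'I_s} := [set i : 'I_s | S i \subset A].
have up (i : 'I_s) : exists2 j : 'I_(size rho), S i \subset nth set0 rho j & True.
  have [|A] := ref (S i); first by rewrite inE mem_nth.
  by rewrite inE => /(nthP set0)[j lt_j <-] sA; exists (Ordinal lt_j).
have mergeD j : merge (D (nth set0 rho j)) = nth set0 rho j.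
  apply/setP => x; apply/bigcupP/idP => [[i]|xj].
    by rewrite inE => /subsetP sij /sij.
  have [i xi] := osp_cover sigma x; exists i => //; rewrite inE.
  have [l sil _] := up i.
  by rewrite (osp_mem_inj xj (subsetP sil x xi)).
have cD : is_chain [set: 'I_s] [seq D A | A <- rho].
  apply/and3P; split.
  - apply/mapP => -[A /(nthP set0)[j lt_j <-] D0].
    have := osp_neq0 lt_j.
    by rewrite -mergeD -D0 /merge_block big_set0 eqxx.
  - rewrite pairwise_map; apply/(pairwiseP set0) => k l lt_k lt_l lt_kl.
    apply/block_ltP => x y; rewrite !inE => xk yl; rewrite ltNge; apply/negP.
    rewrite le_eqVlt => /orP[/eqP eyx|lt_yx].
      have ekl : k = l.
        by apply: osp_nth_inj lt_k lt_l (osp_neq0 (ltn_ord x)) xk _; rewrite -eyx.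
      by rewrite ekl ltnn in lt_kl.
    have := ord y x l k (ltn_ord x) lt_l lt_k lt_yx yl xk.
    by rewrite leqNgt lt_kl.
  - apply/eqP/setP => i; rewrite inE; apply/mem_bigcup_seq.
    have [j sij _] := up i; exists (D (nth set0 rho j)); last by rewrite inE.
    by rewrite map_f ?mem_nth.
exists (intpart_of_chain cD); apply: val_inj => /=.
rewrite intpart_seq_of_chain /merge_blocks -map_comp.
by apply: map_id_in => A /(nthP set0)[j _ <-]; apply: mergeD.
Qed.

Lemma nblocks_merge B : nblocks_in sigma (merge B) = #|B|.
Proof.
rewrite /nblocks_in -sum1_count (big_nth set0) big_mkord -sum1_card.
by apply: eq_bigl => i; rewrite sub_merge.
Qed.

End Merge.

Theorem propositionA24 (n : nat) (sigma pi : osp n) (le_sigma_pi : (sigma <= pi)%O) :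
  let s := size sigma in
  let p := size pi in
  let k := fun j : 'I_p => nblocks_in sigma (nth set0 pi j) in
  let is_merge := fun tau : intpart [set: 'I_s] =>
    osp_seq pi = merge_blocks (intpart_seq tau) in
  [/\ \sum_(j < p) k j = s,
      exists! tau : intpart [set: 'I_s], is_merge tau
    & forall tau : intpart [set: 'I_s], is_merge tau ->
      let T := fun j : 'I_p => nth set0 (intpart_seq tau) j in
      (forall j, k j = #|T j|) /\
      exists (Phi : intpart_prod T -> osp_interval sigma pi)
             (Phi_inv : osp_interval sigma pi -> intpart_prod T),
        [/\ forall t : intpart_prod T,
              osp_seq (sval (Phi t)) =
              flatten [seq merge_blocks (intpart_seq (t j)) | j <- enum 'I_p],
            cancel Phi Phi_inv,
            cancel Phi_inv Phi,
            forall t u : intpart_prod T,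
              (sval (Phi t) <= sval (Phi u))%O = prod_le t u
          & exists (e : forall j : 'I_p, 'I_(k j) -> 'I_s)
                   (Psi : osp_interval sigma pi ->
                          intpart_prod (fun j : 'I_p => [set: 'I_(k j)])),
              [/\ forall j, order_iso_onto (e j) (T j),
                  forall (rho : osp_interval sigma pi) (j : 'I_p),
                    intpart_set (Phi_inv rho j) =
                    [set e j @: (B : {set _}) | B in intpart_set (Psi rho j)],
                  bijective Psi
                & forall rho rho' : osp_interval sigma pi,
                    prod_le (Psi rho) (Psi rho') = (sval rho <= sval rho')%O]]].
Proof.
move=> s p k is_merge.
have is_mergeE tau : is_merge tau -> pi = merge_of tau by move=> h; apply: val_inj.
have kE tau (j : 'I_p) : is_merge tau -> k j = #|nth set0 (intpart_seq tau) j|.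
  by move=> m; rewrite /k [in nth _ pi _](is_mergeE tau m) nth_merge_of nblocks_merge.
have sizeE tau : is_merge tau -> size (intpart_seq tau) = p.
  by move=> m; rewrite /p m size_map.
have [tau0 def_pi] := merge_of_surj le_sigma_pi.
have m0 : is_merge tau0 by rewrite /is_merge -def_pi.
split.
- rewrite -[RHS]card_ord -[RHS]cardsT -(sum_card_intpart_seq tau0).
  rewrite (big_nth set0) (sizeE _ m0) big_mkord.
  by apply: eq_bigr => j _; apply: kE.
- exists tau0; split=> // tau m; apply: merge_of_inj.
  by rewrite def_pi; apply: is_mergeE.
move=> tau m T; split; first by move=> j; apply: kE.
have st := sizeE tau m; have pi_tau := is_mergeE tau m.
have Phi_mem (t : intpart_prod T) : (sigma <= merge_of (join st t) <= pi)%O.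
  by rewrite merge_of_ge pi_tau merge_of_le join_le_coarse.
pose Phi (t : intpart_prod T) : osp_interval sigma pi :=
  exist (fun rho : osp n => (sigma <= rho <= pi)%O) _ (Phi_mem t).
have Phi_le t u : (sval (Phi t) <= sval (Phi u))%O = prod_le t u.
  by rewrite merge_of_le join_le.
(* Injectivity comes for free from [Phi] reflecting the order; the inverse is
   then any function choosing preimages. *)
have Phi_inj : injective Phi.
  move=> t u eq_tu; apply/ffunP => j; apply: le_anti.
  have /forallP/(_ j)-> : prod_le t u by rewrite -Phi_le eq_tu lexx.
  by have /forallP/(_ j)-> : prod_le u t by rewrite -Phi_le eq_tu lexx.
have Phi_surj (rho : osp_interval sigma pi) :
    exists t : {dffun forall j, intpart (T j)}, Phi t == rho.
  case: rho => rho h; case/andP: (h) => le_sr le_rp.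
  have [tau' def_rho] := merge_of_surj le_sr.
  have [|t def_t] := @join_surj _ _ _ tau p st tau'.
    by rewrite -merge_of_le def_rho -pi_tau.
  by exists t; rewrite -val_eqE /= def_t def_rho.
pose Phi_inv rho : intpart_prod T := xchoose (Phi_surj rho).
have Phi_invK : cancel Phi_inv Phi by move=> rho; apply/eqP/(xchooseP (Phi_surj rho)).
have PhiK : cancel Phi Phi_inv by move=> t; apply: Phi_inj.
have Phi_inv_le rho rho' : prod_le (Phi_inv rho) (Phi_inv rho') = (sval rho <= sval rho')%O.
  by rewrite -Phi_le !Phi_invK.
exists Phi, Phi_inv; split=> //.
  by move=> t; rewrite /= intpart_seq_of_chain /merge_blocks map_flatten -map_comp.
have [e e_iso] := fin_all_exists (fun j : 'I_p => order_iso_exists (kE tau j m)).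
pose f j := push (proj1 (e_iso j)) (proj2 (e_iso j)).
have f_le j P Q : (f j P <= f j Q)%O = (P <= Q)%O by apply: push_le.
pose g j Q := xchoose (push_surj (proj1 (e_iso j)) (proj2 (e_iso j)) Q).
have gK j : cancel (g j) (f j).
  by move=> Q; apply/eqP/(xchooseP (push_surj (proj1 (e_iso j)) (proj2 (e_iso j)) Q)).
have fK j : cancel (f j) (g j).
  by move=> P; apply: le_anti; rewrite -!f_le gK lexx.
pose Psi rho : intpart_prod (fun j : 'I_p => [set: 'I_(k j)]) :=
  finfun (fun j => g j (Phi_inv rho j)).
exists e, Psi; split=> //.
- move=> rho j; rewrite -[in LHS](gK j (Phi_inv rho j)) ffunE.
  exact: push_set.
- exists (fun q : intpart_prod (fun j : 'I_p => [set: 'I_(k j)]) =>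
    Phi (finfun (fun j => f j (q j)))).
    move=> rho; rewrite -[RHS]Phi_invK; congr Phi; apply/ffunP => j.
    by rewrite !ffunE gK.
  by move=> q; apply/ffunP => j; rewrite ffunE PhiK ffunE fK.
- move=> rho rho'; rewrite -Phi_inv_le; apply: eq_forallb => j.
  by rewrite !ffunE -f_le !gK.
Qed.
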